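(* Let $\mathcal X$ be a discrete instance space with unweighted improvement graph $G=(\mathcal X,E)$ having a self-loop at every node, let $\mathcal Y=\{z_1,\dots,z_k\}$ be a finite label set with preference order $z_1<z_2<\dots<z_k$, and let $\mathcal H\subseteq\mathcal Y^{\mathcal X}$ be a nonempty hypothesis class. The optimal mistake bound of deterministic learners in multiclass online learning with improvement and bandit feedback, for sequences realizable by $\mathcal H$, equals $\mathrm{BILdim}(\mathcal H)$.
   Context: Improvement graph: $G=(\mathcal X,E)$ is a directed graph; $\Delta(x)=\{v:(x,v)\in E\}$, and $x\in\Delta(x)$ for all $x$. Best response: given $h:\mathcal X\to\mathcal Y$ and $x$, if no $v\in\Delta(x)$ has $h(v)>h(x)$, the agent stays at $x$; otherwise it moves to some $v\in\Delta(x)$ for which $h(v)$ is the most preferred label among $\{h(u):u\in\Delta(x)\}$ (ties broken adversarially). Game: at each round $t=1,2,\dots$: the environment presents $x^{(t)}$; the learner, as a deterministic function of everything observed so far, implements $h^{(t)}:\mathcal X\to\mathcal Y$; the agent best responds, ending at $v^{(t)}\in\Delta(x^{(t)})$; the environment selects $y^{(t)}\in\mathcal Y$; the learner makes a mistake iff $h^{(t)}(v^{(t)})\neq y^{(t)}$. Bandit feedback: the learner is only told whether it made a mistake, not the true label. A run is realizable by $\mathcal H$ if there is $h^*\in\mathcal H$ with $h^*(v^{(t)})=y^{(t)}$ for all $t$. The optimal mistake bound is the infimum over deterministic learners of the supremum, over realizable runs, of the number of mistakes (possibly $\infty$). Bandit multiclass ILT (BILT): a rooted tree whose nodes are labeled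 by elements of $\mathcal X$, in which each internal node labeled $x$ has exactly the following outgoing edges: $k$ edges labeled $(x,z_i)$, $i=1,\dots,k$; and for each $v\in\Delta(x)\setminus\{x\}$, $k-1$ edges labeled $(v,z_i)$, $i=2,\dots,k$. Depth is the length of the shortest root-to-leaf branch. A BILT is shattered by $\mathcal H$ if for every branch with edge labels $(u_1,y_1),(u_2,y_2),\dots$ there is $h\in\mathcal H$ with $h(u_i)\neq y_i$ for all $i$. $\mathrm{BILdim}(\mathcal H)$ is the maximum depth of a BILT shattered by $\mathcal H$ ($\infty$ if unbounded; a single-node tree has depth $0$). *)

(* Defs.v *)
From HB Require Import structures.
From mathcomp Require Import all_boot all_order all_algebra.
From mathcomp Require Import all_classical all_reals all_analysis.

Set Implicit Arguments.
Unset Strict Implicit.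
Unset Printing Implicit Defensive.

Import Order.TTheory GRing.Theory Num.Theory.
Local Open Scope classical_set_scope.
Local Open Scope ring_scope.
Local Open Scope ereal_scope.

(* The label set {z_1 < ... < z_k} is 'I_k with its usual order, z_i being the
   ordinal of value i - 1. In particular a label y is one of z_2, ..., z_k iff
   (0 < y)%N. Mistake bounds and depths are natural numbers or +oo; they are
   taken in \bar R. *)

Section Improvement.
Variables (X : Type) (E : set (X * X)) (k : nat).

Definition Delta (x : X) : set X := [set v | E (x, v)].

Definition improvable (h : X -> 'I_k) (x : X) : Prop :=
  exists2 v, Delta x v & (h x < h v)%N.

(* [best_response h x v]: v is a possible final position of an agent starting
   at x; there may be several such v because of ties. *)
Definition best_response (h : X -> 'I_k) (x v : X) : Prop :=
  (~ improvable h x -> v = x) /\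
  (improvable h x ->
     Delta x v /\ forall u, Delta x u -> (h u <= h v)%N).

(* What is observed in a completed round: the initial and final positions of
   the agent, and whether the learner made a mistake. *)
Definition observation : Type := (X * X * bool)%type.

(* A deterministic learner chooses the classifier of the current round from
   the observations of the past rounds and the current initial position. Its
   own past classifiers are a function of these data. *)
Definition learner : Type := seq observation -> X -> X -> 'I_k.

Record run := Run {
  start : nat -> X;
  final : nat -> X;
  label : nat -> 'I_k }.

Fixpoint history (L : learner) (r : run) (t : nat) : seq observation :=
  if t is t'.+1 then
    let past := history L r t' in
    rcons past (start r t', final r t',
                L past (start r t') (final r t') != label r t')
  else [::].

Definition implemented (L : learner) (r : run) (t : nat) : X -> 'I_k :=
  L (history L r t) (start r t).

Definition run_of (L : learner) : set run :=
  [set r | forall t,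
     best_response (implemented L r t) (start r t) (final r t)].

Definition realizable (H : set (X -> 'I_k)) : set run :=
  [set r | exists2 h, H h & forall t, h (final r t) = label r t].

Definition mistake (L : learner) (r : run) (t : nat) : bool :=
  implemented L r t (final r t) != label r t.

Definition edge : Type := (X * 'I_k)%type.

(* The labels of the outgoing edges of an internal node labeled x. *)
Definition outgoing (x : X) (e : edge) : Prop :=
  e.1 = x \/ [/\ Delta x e.1, e.1 <> x & (0 < e.2)%N].

(* Coinductive, so that trees with infinite branches are allowed. *)
CoInductive bilt : Type :=
| Leaf of X
| Node (x : X) of (forall e : edge, outgoing x e -> bilt).

Inductive finite_branch : bilt -> seq edge -> Prop :=
| finite_branch_leaf x : finite_branch (Leaf x) [::]
| finite_branch_node x (T : forall e, outgoing x e -> bilt) e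
    (xe : outgoing x e) p :
    finite_branch (T e xe) p -> finite_branch (Node T) (e :: p).

CoInductive infinite_branch : bilt -> (nat -> edge) -> Prop :=
| infinite_branch_node x (T : forall e, outgoing x e -> bilt) w
    (xw : outgoing x (w 0%N)) :
    infinite_branch (T (w 0%N) xw) (fun n => w n.+1) ->
    infinite_branch (Node T) w.

Definition shattered (H : set (X -> 'I_k)) : set bilt :=
  [set T |
    (forall p, finite_branch T p -> exists2 h, H h &
       forall i e, onth p i = Some e -> h e.1 <> e.2) /\
    (forall w, infinite_branch T w -> exists2 h, H h &
       forall i, h (w i).1 <> (w i).2)].

Variable R : realType.

Definition mistakes (L : learner) (r : run) : \bar R :=
  \sum_(0 <= t <oo) (mistake L r t)%:R%:E.

Definition optimal_mistake_bound (H : set (X -> 'I_k)) : \bar R :=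
  ereal_inf [set ereal_sup [set mistakes L r | r in run_of L `&` realizable H]
            | L in [set: learner]].

(* A tree without leaves has depth ereal_inf set0 = +oo. *)
Definition depth (T : bilt) : \bar R :=
  ereal_inf [set (size p)%:R%:E | p in finite_branch T].

Definition BILdim (H : set (X -> 'I_k)) : \bar R :=
  ereal_sup [set depth T | T in shattered H].

End Improvement.

(* Main.v *)
Require Import Defs.
From mathcomp Require Import all_boot all_order all_algebra.
From mathcomp Require Import all_classical all_reals all_analysis.

Set Implicit Arguments.
Unset Strict Implicit.
Unset Printing Implicit Defensive.

Import Order.TTheory GRing.Theory Num.Theory.
Local Open Scope classical_set_scope.

(** Lower bound: against a given learner, the environment descends a shattered
    tree along the edges (v, h(v)), where v is the best response at the current
    node to the implemented classifier h, and always declares a mistake; such an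
    edge exists because an agent that moves ends at a label above z_1.

    Upper bound: if no tree of depth n + 1 is shattered by the version space V,
    then for every x some outgoing edge (v, y) of x is such that no tree of depth
    n is shattered by {g in V : g(v) <> y}. The learner implements the classifier
    with value y at v and z_1 elsewhere, so that the agent ends at v with
    prediction y, and each mistake lowers the bound on the dimension by one. *)

(** * Shattered trees and their subtrees *)

Section Branches.
Context {X : Type} {E : set (X * X)} {k : nat}.
Implicit Types (V : set (X -> 'I_k)) (T : bilt E k).

Lemma finite_branch_inv T p : finite_branch T p ->
  match T with
  | Leaf _ => p = [::]
  | Node x T' => exists e (xe : outgoing E x e) q,
      p = e :: q /\ finite_branch (T' e xe) q
  end.
Proof. by case=> // x T' e xe q Tq; exists e, xe, q. Qed.

Lemma infinite_branch_inv T w : infinite_branch T w ->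
  match T with
  | Leaf _ => False
  | Node x T' => exists xw : outgoing E x (w 0%N),
      infinite_branch (T' (w 0%N) xw) (fun n => w n.+1)
  end.
Proof. by case=> x T' {}w xw Tw; exists xw. Qed.

(** A lower bound on depth in [nat]: a shattered tree without finite branches meets it for every
    [n], so infinite depth needs no separate case. *)
Definition shatters_depth V (n : nat) : Prop :=
  exists2 T : bilt E k, shattered V T &
    forall p, finite_branch T p -> (n <= size p)%N.

Definition avoiding V (e : edge X k) : set (X -> 'I_k) :=
  [set g | V g /\ g e.1 <> e.2].

Lemma shatters_depth0 V (h : X -> 'I_k) (x : X) : V h -> shatters_depth V 0.
Proof.
move=> Vh; exists (Leaf E k x) => //; split=> [p|w].
  by move=> /finite_branch_inv ->; exists h => // -[].
by move=> /infinite_branch_inv.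
Qed.

(** Trees chosen for all outgoing edges are grafted under a root labeled [x]. A hypothesis serving a
    branch of the subtree at [e] lies in [avoiding V e], so it also avoids the first edge. *)
Lemma shatters_depthS V n (x : X) :
  (forall e, outgoing E x e -> shatters_depth (avoiding V e) n) ->
  shatters_depth V n.+1.
Proof.
move=> sh; pose T e xe := s2val (cid2 (sh e xe)).
have shT e xe : shattered (avoiding V e) (T e xe) := s2valP (cid2 (sh e xe)).
have leT e xe p : finite_branch (T e xe) p -> (n <= size p)%N.
  exact: (s2valP' (cid2 (sh e xe))).
exists (Node T); last first.
  move=> p /finite_branch_inv [e [xe [q [-> Tq]]]].
  exact: (leT e xe).
split=> [p|w].
  move=> /finite_branch_inv [e [xe [q [-> Tq]]]].
  have [h [Vh he] hq] := (shT e xe).1 q Tq.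
  exists h => // -[|i] e' /=; first by case=> <-.
  exact: hq.
move=> /infinite_branch_inv [xw Tw].
have [h [Vh he] hw] := (shT _ xw).2 _ Tw.
by exists h => // -[].
Qed.

Lemma exists_reducing_edge V n (x : X) : ~ shatters_depth V n.+1 ->
  exists e, outgoing E x e /\ ~ shatters_depth (avoiding V e) n.
Proof.
move=> nV; apply: contrapT => no; apply: nV; apply: (@shatters_depthS _ _ x).
by move=> e xe; apply: contrapT => ne; apply: no; exists e.
Qed.

End Branches.
Arguments shatters_depth {X} E {k} V n.

(** * Best responses, in general and to spike classifiers *)

Section BestResponse.
Context {X : Type} (E : set (X * X)) {k : nat}.
Implicit Types h : X -> 'I_k.

(** The maximum is taken over attained labels, which are finitely many even if [Delta E x] is
    infinite. *)
Lemma best_response_exists h x : exists v, best_response E h x v.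
Proof.
have [imp|nimp] := pselect (improvable E h x); last by exists x; split.
have [v0 xv0 _] := imp.
pose P := [pred i | `[< exists2 u, Delta E x u & h u = i >]].
have P0 : P (h v0) by apply/asboolP; exists v0.
case: (arg_maxnP (fun i : 'I_k => val i) P0) => i /asboolP [v xv <-] vmax.
exists v; split=> // _; split=> // u xu.
by apply: vmax; apply/asboolP; exists u.
Qed.

Definition response h x : X := sval (cid (best_response_exists h x)).

Lemma responseP h x : best_response E h x (response h x).
Proof. exact: svalP (cid (best_response_exists h x)). Qed.

Lemma best_response_outgoing h x v :
  best_response E h x v -> outgoing E x (v, h v).
Proof.
case=> stay move_; have [imp|/stay ->] := pselect (improvable E h x); last by left.
have [xv vmax] := move_ imp; have [u xu hxu] := imp.
have lt_xv : (h x < h v)%N := leq_trans hxu (vmax u xu).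
right; split=> //=; last exact: leq_ltn_trans lt_xv.
by move=> vx; rewrite vx ltnn in lt_xv.
Qed.

(** This is z_1; since [k] may be 0, the argument [y] witnesses that a label exists. *)
Definition bottom (y : 'I_k) : 'I_k :=
  Ordinal (leq_ltn_trans (leq0n y) (ltn_ord y)).

Definition spike (e : edge X k) : X -> 'I_k :=
  fun u => if `[< u = e.1 >] then e.2 else bottom e.2.

Lemma spike_top e : spike e e.1 = e.2.
Proof. by rewrite /spike asboolT. Qed.

Lemma spike_bottom e u : u <> e.1 -> spike e u = bottom e.2.
Proof. by move=> ue; rewrite /spike asboolF. Qed.

Lemma spike_le e u : (spike e u <= e.2)%N.
Proof. by rewrite /spike; case: ifP. Qed.

(** If [e.1] is [x], no label exceeds [e.2] and the agent stays. Otherwise [x] carries z_1 and [e.1]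
    is the only vertex with a higher label, so ties cannot arise. *)
Lemma best_response_spike x e v : outgoing E x e ->
  best_response E (spike e) x v -> v = e.1.
Proof.
case=> [ex|[xe ex e0]] [stay move_].
  rewrite ex; apply: stay => -[u _].
  by rewrite -{1}ex spike_top ltnNge spike_le.
have imp : improvable E (spike e) x.
  by exists e.1 => //; rewrite spike_top spike_bottom// => /esym.
have [_ /(_ _ xe)] := move_ imp.
apply: contraPP => ve; rewrite spike_top spike_bottom//=.
by rewrite leqn0 => /eqP e20; rewrite e20 in e0.
Qed.

End BestResponse.

(** * The version-space learner *)

Section Learner.
Context {X : Type} (E : set (X * X)) {k : nat}.
Variables (H : set (X -> 'I_k)) (n : nat) (h0 : X -> 'I_k).

(** The fallback [(x, h0 x)] is never taken when [V] shatters no tree of depth [m.+1]; [h0] supplies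
    a label for it. *)
Definition choose_edge V m x : edge X k :=
  if pselect (exists e, outgoing E x e /\ ~ shatters_depth E (avoiding V e) m)
    is left ex then sval (cid ex) else (x, h0 x).

Lemma choose_edgeP V m x : ~ shatters_depth E V m.+1 ->
  outgoing E x (choose_edge V m x) /\
  ~ shatters_depth E (avoiding V (choose_edge V m x)) m.
Proof.
move=> /(exists_reducing_edge x) ex; rewrite /choose_edge.
by case: pselect => // ex'; exact: svalP (cid ex').
Qed.

(* A state (V, m) is meant for V shattering no tree of depth m. *)
Definition update (s : set (X -> 'I_k) * nat) (o : observation X) :=
  if o.2 then (avoiding s.1 (choose_edge s.1 s.2.-1 o.1.1), s.2.-1) else s.

Definition state (past : seq (observation X)) := foldl update (H, n) past.

Definition version_learner : learner X k := fun past x =>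
  spike (choose_edge (state past).1 (state past).2.-1 x).

Hypothesis nH : ~ shatters_depth E H n.

(** The second component of the state is a potential: it drops by one at each mistake and is
    constant otherwise. *)
Lemma state_invariant (r : run X k) h :
  run_of E version_learner r -> H h -> (forall t, h (final r t) = label r t) ->
  forall t, let s := state (history version_learner r t) in
    [/\ s.1 h, ~ shatters_depth E s.1 s.2 &
        (\sum_(0 <= i < t) mistake version_learner r i + s.2 = n)%N].
Proof.
move=> rL Hh hr; elim=> [|t]; first by split=> //; rewrite big_nil.
cbv zeta; set s := state _ => -[sh nsh sn].
have -> : state (history version_learner r t.+1) =
    update s (start r t, final r t, mistake version_learner r t).
  by rewrite /state /= foldl_rcons.
rewrite big_nat_recr//=; case mt: (mistake _ r t); last by rewrite addn0.
(* The potential is not 0 here: the version space contains [h], hence shatters a single leaf. *)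
rewrite /update /=; case: {-1}s.2 (erefl s.2) => [|m] sm.
  by case: nsh; rewrite sm; exact: (shatters_depth0 (start r t) sh).
rewrite sm in nsh; have [xe ne] := choose_edgeP (start r t) nsh.
set e := choose_edge s.1 m (start r t) in xe ne *.
have impE : implemented version_learner r t = spike e.
  by rewrite /implemented /version_learner -/s sm.
have fe : final r t = e.1.
  by apply: (best_response_spike xe); rewrite -impE; exact: rL.
split=> //=; last by rewrite -sn sm -addnA.
(* A mistake means that the true label, [h e.1], differs from the prediction [e.2], so [h] survives
   the update. *)
split=> // he; move: mt; rewrite /mistake impE fe spike_top -he -fe hr.
by rewrite eqxx.
Qed.

(** The inequality is strict because the target hypothesis stays in the version space, which keeps
    the potential positive. *)
Lemma version_learner_bound (r : run X k) :
  run_of E version_learner r -> realizable H r ->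
  forall t, (\sum_(0 <= i < t) mistake version_learner r i < n)%N.
Proof.
move=> rL [h Hh hr] t; have [sh nsh <-] := state_invariant rL Hh hr t.
rewrite -[ltnLHS]addn0 ltn_add2l lt0n; apply/eqP => s0.
by apply: nsh; rewrite s0; exact: (shatters_depth0 (start r t) sh).
Qed.

End Learner.

(** * The adversary walking down a tree *)

Section Environment.
Context {X : Type} (E : set (X * X)) {k : nat}.
Variable L : learner X k.
Implicit Types (T : bilt E k) (s : seq (observation X) * bilt E k).

Definition root T : X := match T with Leaf x => x | Node x _ => x end.

Definition is_leaf T : bool := if T is Leaf _ then true else false.

Definition move_edge (past : seq (observation X)) (x : X) : edge X k :=
  (response E (L past x) x, L past x (response E (L past x) x)).

Lemma move_edge_outgoing past x : outgoing E x (move_edge past x).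
Proof. exact: best_response_outgoing (responseP E (L past x) x). Qed.

Definition descend s : seq (observation X) * bilt E k :=
  match s.2 with
  | Leaf _ => s
  | Node x T => (rcons s.1 (x, (move_edge s.1 x).1, true),
                 T (move_edge s.1 x) (move_edge_outgoing s.1 x))
  end.

(** Descending before recursing makes [walk s t.+1] compute to [walk (descend s) t], the shape used
    in building branches from the root; [walkS] is the other unfolding. *)
Fixpoint walk s (t : nat) : seq (observation X) * bilt E k :=
  if t is t'.+1 then walk (descend s) t' else s.

Lemma walkS s t : walk s t.+1 = descend (walk s t).
Proof. by elim: t s => //= t IHt s; rewrite -IHt. Qed.

Definition walk_edge s t : edge X k :=
  move_edge (walk s t).1 (root (walk s t).2).

Lemma walk_finite_branch t s :
  (forall i, (i < t)%N -> ~~ is_leaf (walk s i).2) -> is_leaf (walk s t).2 ->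
  finite_branch s.2 (mkseq (walk_edge s) t).
Proof.
elim: t s => [|t IHt] [past T] inner leaf.
  by case: T leaf {inner} => //= x _; exact: finite_branch_leaf.
rewrite /mkseq /= (iotaDl 1 0 t) -map_comp.
case: T leaf inner => [x _ /(_ 0%N isT)//|x T leaf inner] /=.
apply: (@finite_branch_node _ _ _ x T _ (move_edge_outgoing past x)).
exact: (IHt (descend (past, Node T)) (fun i => inner i.+1) leaf).
Qed.

Lemma walk_infinite_branch s :
  (forall t, ~~ is_leaf (walk s t).2) -> infinite_branch s.2 (walk_edge s).
Proof.
move: s; cofix IH => -[past [x|x T] inner]; first by have := inner 0%N.
apply: (@infinite_branch_node _ _ _ x T (walk_edge (past, Node T))
  (move_edge_outgoing past x)).
exact: (IH (descend (past, Node T)) (fun t => inner t.+1)).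
Qed.

Variables (s0 : seq (observation X) * bilt E k) (h : X -> 'I_k).

(** A suitable [h] is known only once the walk has fixed a whole branch, so the run is replayed with
    labels from [h]. Both histories agree as long as the walk is at internal nodes and [h] avoids
    its edges; past a leaf the run goes on from the label of that leaf and stays realizable. *)
Fixpoint play (t : nat) : seq (observation X) :=
  if t is t'.+1 then
    let e := move_edge (play t') (root (walk s0 t').2) in
    rcons (play t') (root (walk s0 t').2, e.1, e.2 != h e.1)
  else [::].

Definition play_run : run X k :=
  let v t := (move_edge (play t) (root (walk s0 t).2)).1 in
  Run (fun t => root (walk s0 t).2) v (h \o v).

Lemma history_play t : history L play_run t = play t.
Proof. by elim: t => //= t ->. Qed.

Lemma play_run_of : run_of E L play_run.
Proof. by move=> t; rewrite /implemented history_play; exact: responseP. Qed.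

Lemma play_realizable (H : set (X -> 'I_k)) : H h -> realizable H play_run.
Proof. by move=> Hh; exists h. Qed.

Hypothesis s0nil : s0.1 = [::].

Lemma play_walk t :
  (forall i, (i < t)%N -> ~~ is_leaf (walk s0 i).2) ->
  (forall i, (i < t)%N -> h (walk_edge s0 i).1 <> (walk_edge s0 i).2) ->
  play t = (walk s0 t).1.
Proof.
elim: t => [//|t IHt] inner he; rewrite walkS /=.
rewrite IHt; [|by move=> i /ltnW /inner|by move=> i /ltnW /he].
have := inner t (ltnSn t); have := he t (ltnSn t).
rewrite /walk_edge /descend; case: (walk s0 t) => past [//|x T] /= /eqP.
by rewrite eq_sym => ->.
Qed.

Lemma play_mistake t :
  (forall i, (i < t)%N -> ~~ is_leaf (walk s0 i).2) ->
  (forall i, (i < t)%N -> h (walk_edge s0 i).1 <> (walk_edge s0 i).2) ->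
  forall i, (i < t)%N -> mistake L play_run i.
Proof.
move=> inner he i it; rewrite /mistake /implemented history_play /=.
rewrite play_walk; first by rewrite eq_sym; apply/eqP; exact: he.
  by move=> j ji; apply: inner; exact: ltn_trans it.
by move=> j ji; apply: he; exact: ltn_trans it.
Qed.

End Environment.

Local Open Scope ring_scope.
Local Open Scope ereal_scope.

(** * The two inequalities in the extended reals *)

Section Bounds.
Context {R : realType} {X : Type} (E : set (X * X)) {k : nat}.
Implicit Types (L : learner X k) (r : run X k) (H : set (X -> 'I_k)).

Lemma nat_unbounded (x : \bar R) : (forall n, n%:R%:E <= x) -> x = +oo.
Proof.
move=> nx; apply: eq_infty => a; apply: le_trans (nx (Num.truncn a).+1).
by rewrite lee_fin ltW// truncnS_gt.
Qed.

Lemma partial_mistakes L r t :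
  \sum_(0 <= i < t) (mistake L r i)%:R%:E =
  (\sum_(0 <= i < t) mistake L r i)%N%:R%:E :> \bar R.
Proof. by rewrite sumEFin natr_sum. Qed.

Lemma mistakes_le L r d :
  (forall t, (\sum_(0 <= i < t) mistake L r i <= d)%N) ->
  mistakes R L r <= d%:R%:E.
Proof.
move=> le_d; apply: lime_le.
  by apply: is_cvg_nneseries => i _ _; rewrite lee_fin.
by apply: nearW => t; rewrite partial_mistakes lee_fin ler_nat.
Qed.

Lemma mistakes_ge L r t :
  (forall i, (i < t)%N -> mistake L r i) -> t%:R%:E <= mistakes R L r.
Proof.
move=> all_m; apply: (@le_trans _ _ (\sum_(0 <= i < t) (mistake L r i)%:R%:E)).
  rewrite partial_mistakes lee_fin ler_nat (@eq_big_nat _ _ _ _ _ _ (fun=> 1%N)).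
    by rewrite sum_nat_const_nat muln1 subn0.
  by move=> i /andP[_ /all_m ->].
by apply: nneseries_lim_ge => i _ _; rewrite lee_fin.
Qed.

Lemma shatters_depth_BILdim H d :
  shatters_depth E H d -> d%:R%:E <= BILdim E R H.
Proof.
move=> [T HT dT]; apply: (@le_trans _ _ (depth R T)).
  by apply: le_ereal_inf_tmp => _ [p Tp <-]; rewrite lee_fin ler_nat; exact: dT.
by apply: ereal_sup_ubound; exists T.
Qed.

Lemma BILdim_le_mistakes H L :
  BILdim E R H <=
  ereal_sup [set mistakes R L r | r in run_of E L `&` realizable H].
Proof.
apply: ge_ereal_sup => _ [T [HTf HTi] <-].
pose s0 : seq (observation X) * bilt E k := ([::], T).
have play_le h : H h -> mistakes R L (play_run L s0 h) <=
    ereal_sup [set mistakes R L r | r in run_of E L `&` realizable H].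
  move=> Hh; apply: ereal_sup_ubound; exists (play_run L s0 h) => //.
  by split; [exact: play_run_of|exact: play_realizable].
(* The first leaf reached ends a finite branch, at least as long as the depth. A walk that reaches
   none forces infinitely many mistakes, whatever the depth. *)
have [someleaf|noleaf] := pselect (exists n, is_leaf (walk L s0 n).2).
  have [n leaf nmin] := ex_minnP someleaf.
  have inner i : (i < n)%N -> ~~ is_leaf (walk L s0 i).2.
    by move=> ni; apply/negP => /nmin; rewrite leqNgt ni.
  have br := walk_finite_branch inner leaf.
  have [h Hh hp] := HTf _ br.
  apply: (@le_trans _ _ n%:R%:E).
    apply: ereal_inf_lbound; exists (mkseq (walk_edge L s0) n) => //.
    by rewrite size_mkseq.
  apply: le_trans (play_le h Hh).
  apply: mistakes_ge; apply: play_mistake => // i ni; apply: (hp i).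
  by rewrite onthE -map_comp (nth_map 0%N) ?size_iota// nth_iota.
have inner t : ~~ is_leaf (walk L s0 t).2.
  by apply/negP => leaf; apply: noleaf; exists t.
have [h Hh hw] := HTi _ (walk_infinite_branch inner).
apply: le_trans (play_le h Hh).
suff -> : mistakes R L (play_run L s0 h) = +oo by rewrite leey.
apply: nat_unbounded => n.
by apply: mistakes_ge; apply: play_mistake => // i _; exact: hw.
Qed.

Lemma optimal_le_BILdim H (h0 : X -> 'I_k) :
  optimal_mistake_bound E R H <= BILdim E R H.
Proof.
have [all_n|] := pselect (forall n, shatters_depth E H n).
  suff -> : BILdim E R H = +oo by rewrite leey.
  apply: nat_unbounded => n.
  exact: shatters_depth_BILdim.
move=> /existsNP [n1 /asboolP nH1].
have [n /asboolP nH nmin] :=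
  ex_minnP (ex_intro (fun n => `[< ~ shatters_depth E H n >]) n1 nH1).
apply: (@le_trans _ _ (ereal_sup [set mistakes R (version_learner E H n h0) r |
    r in run_of E (version_learner E H n h0) `&` realizable H])).
  by apply: ereal_inf_lbound; exists (version_learner E H n h0).
apply: ge_ereal_sup => _ [r [rL rH] <-].
have bound := version_learner_bound nH rL rH.
(* The least unshattered depth [n] is not 0, as the strict bound would fail. For [n] equal to
   [d.+1], there are at most [d] mistakes, and depth [d] is shattered by minimality. *)
case: n => [|d] in nH nmin rL bound *; first by have := bound 0%N.
apply: (@le_trans _ _ d%:R%:E); first exact: mistakes_le.
apply: shatters_depth_BILdim; apply: contrapT => /asboolP /nmin.
by rewrite ltnn.
Qed.

End Bounds.

Theorem theorem3 (R : realType) (X : Type) (E : set (X * X)) (k : nat)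
    (H : set (X -> 'I_k)) :
  (forall x : X, E (x, x)) ->
  (exists h : X -> 'I_k, H h) ->
  optimal_mistake_bound E R H = BILdim E R H.
Proof.
move=> _ [h0 _]; apply/eqP; rewrite eq_le optimal_le_BILdim//=.
by apply: le_ereal_inf_tmp => _ [L _ <-]; exact: BILdim_le_mistakes.
Qed.
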